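(* Let $q$ be a prime power and let $k$ and $l$ be positive integers such that $q\ge 5$ and $2\le k\le \min(q-3,\,q-l-1)$. Let $a_1,\ldots,a_l$ be $l$ distinct elements of $\mathbf{F}_q$ and let $D=\mathbf{F}_q\setminus\{a_1,\ldots,a_l\}$. Let $u(x)\in \mathbf{F}_q[x]$ with $\deg u(x)=k$. Then the received word $(u(D), c_{k-1}(u(x)))\in\mathbf{F}_q^{q-l+1}$ is a deep hole of the generalized projective Reed-Solomon code ${\rm GPRS}_q(D,k)$ if and only if the sum $\sum_{y\in I} y$ is nonzero for every subset $I\subseteq D$ with $\#(I)=k$.
   Context: $\mathbf{F}_q$ is the finite field with $q$ elements. Write $D=\{y_1,\ldots,y_{q-l}\}$. For $f(x)\in\mathbf{F}_q[x]$, put $f(D):=(f(y_1),\ldots,f(y_{q-l}))$ and let $c_{k-1}(f(x))$ be the coefficient of $x^{k-1}$ in $f(x)$. The generalized projective Reed-Solomon code is ${\rm GPRS}_q(D,k):=\{(f(D),c_{k-1}(f(x)))\in\mathbf{F}_q^{q-l+1} : f(x)\in\mathbf{F}_q[x],\ \deg f(x)\le k-1\}$ (the zero polynomial included). For a code $C\subseteq \mathbf{F}_q^{N}$, $d(\cdot,\cdot)$ denotes Hamming distance (the number of coordinates in which two words differ), $d(w,C):=\min_{v\in C} d(w,v)$ is the error distance of $w\in\mathbf{F}_q^N$, and $\rho(C):=\max\{d(w,C): w\in\mathbf{F}_q^N\}$ is the covering radius. A word $w\in\mathbf{F}_q^{N}\setminus C$ is a deep hole of $C$ if $d(w,C)=\rho(C)$.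 *)

(* Defs.v *)
From mathcomp Require Import all_boot all_order all_algebra.
Set Implicit Arguments.
Unset Strict Implicit.
Unset Printing Implicit Defensive.
Import GRing.Theory.
Local Open Scope ring_scope.

Definition hamming_dist (F : finFieldType) (N : nat) (v w : 'rV[F]_N) : nat :=
  #|[set i : 'I_N | v 0 i != w 0 i]|.

(* Every Hamming distance is at most N, so the default value N of the iterated
   minimum does not affect the result when C is nonempty. *)
Definition error_dist (F : finFieldType) (N : nat)
    (w : 'rV[F]_N) (C : {set 'rV[F]_N}) : nat :=
  \big[minn/N]_(v in C) hamming_dist w v.

Definition covering_radius (F : finFieldType) (N : nat)
    (C : {set 'rV[F]_N}) : nat :=
  (\max_(w : 'rV[F]_N) error_dist w C)%N.

Definition deep_hole (F : finFieldType) (N : nat)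
    (C : {set 'rV[F]_N}) (w : 'rV[F]_N) : Prop :=
  w \notin C /\ error_dist w C = covering_radius C.

(* The word (f(D), c_{k-1}(f)), where y enumerates D as y_1, ..., y_n.
   Only meaningful for 0 < k, since k.-1 is truncated. *)
Definition gprs_word (F : finFieldType) (n : nat) (y : 'I_n -> F) (k : nat)
    (f : {poly F}) : 'rV[F]_(n + 1) :=
  row_mx (\row_i f.[y i]) (const_mx f`_k.-1).

(* {poly_k F} is the type of polynomials of size at most k, that is, of degree
   at most k - 1, including 0. *)
Definition GPRS (F : finFieldType) (n : nat) (y : 'I_n -> F) (k : nat) :
    {set 'rV[F]_(n + 1)} :=
  [set gprs_word y k (val f) | f : {poly_k F}].

(* Main.v *)
Require Import Defs.
From mathcomp Require Import all_boot all_order all_algebra zify.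
Set Implicit Arguments.
Unset Strict Implicit.
Unset Printing Implicit Defensive.
Import Order.TTheory GRing.Theory.
Local Open Scope ring_scope.

(** Write [n = q - l].  The code has length [n + 1], and the distance from a
    word to a codeword is [n + 1] minus the number of coordinates where they
    agree, so everything comes down to bounding agreements.

    Covering radius: it equals [n + 1 - k] ([covering_radius_GPRS]).  It is at
    most that, since a polynomial of degree less than [k] can be made to match
    any word at [k] of the evaluation points.  For the other inequality, take a
    point [a] outside [D] and consider the word with entries [1 / (y_i - a)] and
    last entry [0].  Its agreements with a codeword [f] on [D] are roots of
    [1 - (x - a) f], which is nonzero because it takes the value [1] at [a]; it
    has degree at most [k], and degree less than [k] when the last coordinate
    agrees, that is, when the coefficient of [x^(k-1)] in [f] vanishes.  Either
    way at most [k] coordinates agree.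

    Distance of the given word: for [deg u = k] and [deg f < k], agreements on
    [D] are roots of [u - f], of degree exactly [k], so there are at most [k + 1]
    agreements in all.  Equality means that [u - f] is a constant times
    the product of the [x - z], [z] in some [k]-subset [I] of [D], and that its
    coefficient of [x^(k-1)], a nonzero multiple of the sum of [I], vanishes; any
    [k]-subset with zero sum arises in this way ([error_dist_deg_k]).  Hence the
    error distance falls below the covering radius exactly when a zero-sum
    [k]-subset exists. *)

(** * Hamming distance and error distance *)

Lemma hamming_dist_agree (F : finFieldType) N (v w : 'rV[F]_N) :
  (hamming_dist v w + #|[set i | v 0%R i == w 0%R i]| = N)%N.
Proof.
rewrite /hamming_dist -[RHS]card_ord -[RHS](cardsC [set i | v 0 i == w 0 i]).
by rewrite addnC; congr (_ + #|pred_of_set _|)%N; apply/setP=> i; rewrite !inE.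
Qed.

Lemma error_dist_le (F : finFieldType) N (w v : 'rV[F]_N) (C : {set 'rV[F]_N}) :
  v \in C -> (error_dist w C <= hamming_dist w v)%N.
Proof.
by move=> Cv; rewrite /error_dist -minEnat -leEnat; apply: bigmin_le_cond.
Qed.

Lemma error_dist_ge (F : finFieldType) N (w : 'rV[F]_N) (C : {set 'rV[F]_N}) m :
  (m <= N)%N -> (forall v, v \in C -> (m <= hamming_dist w v)%N) ->
  (m <= error_dist w C)%N.
Proof.
move=> mN mC; rewrite /error_dist; elim/big_ind: _ => // a b.
by rewrite leq_min => -> ->.
Qed.

Lemma error_dist_attained (F : finFieldType) N (w : 'rV[F]_N)
    (C : {set 'rV[F]_N}) :
  (error_dist w C < N)%N ->
  exists2 v, v \in C & hamming_dist w v = error_dist w C.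
Proof.
move=> dN; case: (boolP [exists v in C, hamming_dist w v == error_dist w C]).
  by case/exists_inP=> v Cv /eqP; exists v.
move/exists_inPn=> no_v; suff: (error_dist w C < error_dist w C)%N by rewrite ltnn.
by apply: error_dist_ge => // v Cv; rewrite ltn_neqAle eq_sym no_v // error_dist_le.
Qed.

(** * Polynomials and their values at distinct points *)

Lemma interpolation (F : fieldType) (I : eqType) (y r : I -> F) (s : seq I) :
    injective y -> uniq s ->
  exists2 f : {poly F}, (size f <= size s)%N & {in s, forall i, f.[y i] = r i}.
Proof.
move=> y_inj; elim: s => [|j s IHs] /=; first by exists 0; rewrite ?size_poly0.
case/andP=> s'j /IHs[f szf fr].
(* Newton form: [g] vanishes on the points of [s] and not at the new one. *)
pose g := \prod_(z <- map y s) ('X - z%:P).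
have szg : size g = (size s).+1 by rewrite size_prod_XsubC size_map.
have gj : g.[y j] != 0.
  by rewrite -[_ == 0]/(root g _) root_prod_XsubC mem_map.
exists (f + ((r j - f.[y j]) / g.[y j]) *: g).
  rewrite (leq_trans (size_polyD _ _)) // geq_max (leq_trans szf) //=.
  by rewrite -szg size_scale_leq.
move=> i; rewrite inE hornerD hornerZ => /predU1P[->|si].
  by rewrite divfK // addrC subrK.
have /eqP-> : g.[y i] == 0 by rewrite -[_ == 0]/(root g _) root_prod_XsubC map_f.
by rewrite mulr0 addr0 fr.
Qed.

Lemma card_roots_lt (F : fieldType) (I : finType) (y : I -> F) (P : {poly F}) :
  injective y -> P != 0 -> (#|[set i | root P (y i)]| < size P)%N.
Proof.
move=> y_inj P0; rewrite cardE -(size_map y); apply: max_poly_roots => //.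
  by apply/allP=> _ /mapP[i + ->]; rewrite mem_enum inE.
by rewrite map_inj_uniq // enum_uniq.
Qed.

(** Vieta's formula for the second highest coefficient. *)
Lemma coef_split_poly (F : finFieldType) (I : {set F}) :
    (0 < #|I|)%N ->
  (\prod_(z in I) ('X - z%:P))`_#|I|.-1 = - \sum_(z in I) z.
Proof.
by move=> I0; rewrite -!big_enum cardE coefPn_prod_XsubC // -cardE -lt0n.
Qed.

Lemma size_split_poly (F : finFieldType) (I : {set F}) :
  size (\prod_(z in I) ('X - z%:P)) = #|I|.+1.
Proof. by rewrite -big_enum size_prod_XsubC -cardE. Qed.

Lemma split_poly_eq (F : finFieldType) (P : {poly F}) (I : {set F}) :
    size P = #|I|.+1 -> {in I, forall z, root P z} ->
  P = lead_coef P *: \prod_(z in I) ('X - z%:P).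
Proof.
move=> szP rP; rewrite -big_enum; apply: all_roots_prod_XsubC.
- by rewrite szP cardE.
- by apply/allP=> z; rewrite mem_enum; apply: rP.
- by rewrite uniq_rootsE enum_uniq.
Qed.

(** * The generalized projective Reed-Solomon code *)

Section GPRSTheory.

Variables (F : finFieldType) (n : nat) (y : 'I_n -> F) (k : nat).
Hypothesis y_inj : injective y.

Let C := GPRS y k.

Lemma GPRSP w :
  reflect (exists2 f : {poly F}, (size f <= k)%N & w = gprs_word y k f) (w \in C).
Proof.
apply: (iffP imsetP) => [[f _ ->]|[f szf ->]]; first by exists (val f); rewrite ?size_npoly.
by exists (NPoly szf).
Qed.

Lemma hamming_dist_gprs_word (r : 'I_n -> F) c f :
  (hamming_dist (row_mx (\row_i r i) (const_mx c)) (gprs_word y k f)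
   + (#|[set i | r i == f.[y i]]| + (c == f`_k.-1)%R) = n + 1)%N.
Proof.
rewrite -[RHS](hamming_dist_agree (row_mx (\row_i r i) (const_mx c)) (gprs_word y k f)).
congr (_ + _)%N; rewrite -!sum1_card !(big_mkcond (fun i => i \in _)) /=.
rewrite big_split_ord big_ord1 /=; congr (_ + _)%N.
  by apply: eq_bigr => i _; rewrite !inE !row_mxEl !mxE.
by rewrite !inE !row_mxEr !mxE; case: eqP.
Qed.

Lemma hamming_dist_gprs_words u f :
  (hamming_dist (gprs_word y k u) (gprs_word y k f)
   + (#|[set i | root (u - f)%R (y i)]| + ((u - f)`_k.-1 == 0)%R) = n + 1)%N.
Proof.
rewrite -[RHS](hamming_dist_gprs_word (fun i => u.[y i]) u`_k.-1 f).
congr (_ + (#|pred_of_set _| + _))%N; last by rewrite coefB subr_eq0.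
by apply/setP=> i; rewrite !inE rootE hornerD hornerN subr_eq0.
Qed.

(** Interpolating [w] at [k] evaluation points gives a codeword that agrees with
    it there. *)
Lemma error_dist_GPRS_le w : (k <= n)%N -> (error_dist w C <= n + 1 - k)%N.
Proof.
move=> kn; pose r i := lsubmx w 0 i; pose c := rsubmx w 0 0.
have -> : w = row_mx (\row_i r i) (const_mx c).
  rewrite -[LHS]hsubmxK; congr row_mx; apply/rowP=> i; rewrite [RHS]mxE //.
  by rewrite ord1.
have [f szf fr] := interpolation r y_inj (take_uniq k (enum_uniq 'I_n)).
rewrite size_takel ?size_enum_ord // in szf.
have Cf : gprs_word y k f \in C by apply/GPRSP; exists f.
apply: leq_trans (error_dist_le _ Cf) _.
have : (k <= #|[set i | r i == f.[y i]]|)%N.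
  have {1}<- : #|[set i in take k (enum 'I_n)]| = k.
    rewrite cardsE (card_uniqP _) ?take_uniq ?enum_uniq //.
    by rewrite size_takel ?size_enum_ord.
  by apply/subset_leq_card/subsetP=> i; rewrite !inE => /fr->.
have := hamming_dist_gprs_word r c f.
by move: (hamming_dist _ _) #|_| (nat_of_bool _) => d m b; lia.
Qed.

Lemma size_sub_deg_k (u f : {poly F}) :
  size u = k.+1 -> (size f <= k)%N -> size (u - f) = k.+1.
Proof. by move=> szu szf; rewrite size_polyDl // size_polyN szu. Qed.

(** A codeword agrees with [u] at the roots of [u - f], which number at most [k],
    and possibly in the last coordinate. *)
Lemma error_dist_deg_k_ge (u : {poly F}) :
  size u = k.+1 -> (n - k <= error_dist (gprs_word y k u) C)%N.
Proof.
move=> szu; apply: error_dist_ge => [|_ /GPRSP[f szf ->]].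
  by rewrite (leq_trans (leq_subr _ _)) ?leq_addr.
have szP := size_sub_deg_k szu szf.
have P0 : u - f != 0 by rewrite -size_poly_gt0 szP.
have := card_roots_lt y_inj P0; rewrite szP.
have := leq_b1 ((u - f)`_k.-1 == 0); have := hamming_dist_gprs_words u f.
by move: (hamming_dist _ _) #|_| (nat_of_bool _) => d m b; lia.
Qed.

Hypothesis k_gt0 : (0 < k)%N.

(** Clearing the denominator turns agreements with [f] at points [y i] into roots of
    [1 - (x - a) f].  The last entry is [0] so that an agreement there lowers the
    degree of this polynomial, which costs one of its possible roots. *)
Lemma error_dist_pole a :
    (forall i, y i != a) -> (k <= n)%N ->
  (n + 1 - k <= error_dist (row_mx (\row_i (y i - a)^-1)%R (const_mx 0%R)) C)%N.
Proof.
move=> ya kn; apply: error_dist_ge => [|_ /GPRSP[f szf ->]]; first exact: leq_subr.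
have := hamming_dist_gprs_word (fun i => (y i - a)^-1) 0 f.
suff : (#|[set i | (y i - a)^-1 == f.[y i]]| + (0 == f`_k.-1)%R <= k)%N.
  by move: (hamming_dist _ _) #|_| (nat_of_bool _) => d m b; lia.
pose P := 1 - ('X - a%:P) * f.
have P0 : P != 0.
  apply/eqP=> /(congr1 (horner^~ a))/eqP.
  by rewrite !hornerE subrr mul0r subr0 oner_eq0.
have size_P m : (size f <= m)%N -> (size P <= m.+1)%N.
  move=> szm; rewrite (leq_trans (size_polyD _ _)) // size_polyN size_poly1 geq_max /=.
  by rewrite (leq_trans (size_polyMleq _ _)) // size_XsubC.
have -> : [set i | (y i - a)^-1 == f.[y i]] = [set i | root P (y i)].
  apply/setP=> i; rewrite !inE rootE !hornerE subr_eq0.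
  have yi : y i - a != 0 by rewrite subr_eq0.
  by rewrite -(inj_eq (mulfI yi)) divff.
have := card_roots_lt y_inj P0.
case: eqP => [/esym fk0|_] lt_P; last first.
  by rewrite addn0 -ltnS (leq_trans lt_P) ?size_P.
rewrite addn1 (leq_trans lt_P) // -(prednK k_gt0) size_P //.
apply/leq_sizeP=> j; rewrite leq_eqVlt => /predU1P[<- //|].
by rewrite prednK // => kj; rewrite nth_default // (leq_trans szf).
Qed.

Lemma covering_radius_GPRS a :
    (forall i, y i != a) -> (k <= n)%N -> covering_radius C = (n + 1 - k)%N.
Proof.
move=> ya kn; apply/eqP; rewrite eqn_leq; apply/andP; split.
  by apply/bigmax_leqP=> w _; apply: error_dist_GPRS_le.
apply: leq_trans (error_dist_pole ya kn) _.
exact: (leq_bigmax (F := fun w => error_dist w C)).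
Qed.

(** The lower bound [n - k] is attained exactly when some [u - f] splits over
    [k] evaluation points and has no term in [x^(k-1)]. *)
Lemma error_dist_deg_k (u : {poly F}) :
    (k <= n)%N -> size u = k.+1 ->
  error_dist (gprs_word y k u) C = (n - k)%N <->
  exists I : {set F}, [/\ I \subset [set y i | i : 'I_n], #|I| = k
                        & \sum_(z in I) z = 0].
Proof.
move=> kn szu; split=> [d_eq | [I [sI cI sum0]]].
  have [|_ /GPRSP[f szf ->]] := error_dist_attained (w := gprs_word y k u) (C := C).
    by rewrite d_eq addn1 ltnS leq_subr.
  rewrite d_eq => hd; have szP := size_sub_deg_k szu szf.
  have P0 : u - f != 0 by rewrite -size_poly_gt0 szP.
  pose Z := [set i | root (u - f) (y i)].
  have [eZ /eqP Pk0] : #|Z| = k /\ (u - f)`_k.-1 == 0.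
    have := hamming_dist_gprs_words u f; rewrite hd.
    have := card_roots_lt y_inj P0; rewrite szP -/Z.
    by move: #|Z| => m; case: (_ == 0) => /=; lia.
  exists (y @: Z); have cI : #|y @: Z| = k by rewrite card_imset.
  have rZ : {in y @: Z, forall z, root (u - f) z}.
    by move=> _ /imsetP[i + ->]; rewrite inE.
  split=> //; first by apply/subsetP=> _ /imsetP[i _ ->]; apply: imset_f.
  (* The [k] agreements at points [y i] are all the roots of [u - f]. *)
  move: Pk0; rewrite (split_poly_eq _ rZ) ?cI // coefZ -{1}cI coef_split_poly ?cI //.
  by move/eqP; rewrite mulf_eq0 lead_coef_eq0 (negPf P0) oppr_eq0 => /eqP.
apply/eqP; rewrite eqn_leq error_dist_deg_k_ge // andbT.
pose P := lead_coef u *: \prod_(z in I) ('X - z%:P).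
have u0 : lead_coef u != 0 by rewrite lead_coef_eq0 -size_poly_gt0 szu.
have szP : size P = k.+1 by rewrite size_scale // size_split_poly cI.
have Pk : P`_k = u`_k.
  have -> : P`_k = lead_coef P by rewrite lead_coefE szP.
  rewrite lead_coefZ -big_enum (monicP (monic_prod_XsubC _ _ _)).
  by rewrite mulr1 lead_coefE szu.
(* Subtracting [P] cancels the leading term of [u], leaving a codeword. *)
have szf : (size (u - P)%R <= k)%N.
  apply/leq_sizeP=> j; rewrite coefB leq_eqVlt => /predU1P[<-|kj].
    by rewrite Pk subrr.
  by rewrite !nth_default ?subr0 ?szP ?szu.
have Cf : gprs_word y k (u - P) \in C by apply/GPRSP; exists (u - P).
apply: leq_trans (error_dist_le _ Cf) _.
have := hamming_dist_gprs_words u (u - P); rewrite subKr.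
have -> : P`_k.-1 = 0.
  by rewrite coefZ -{1}cI coef_split_poly ?cI // sum0 oppr0 mulr0.
suff kZ : (k <= #|[set i | root P (y i)]|)%N.
  by rewrite eqxx; move: (hamming_dist _ _) #|_| kZ => d m; lia.
rewrite -cI -[leqRHS](card_imset _ y_inj); apply/subset_leq_card/subsetP=> z Iz.
have /imsetP[i _ zi] := subsetP sI z Iz; rewrite zi imset_f // inE -zi.
by rewrite rootZ // -big_enum root_prod_XsubC mem_enum.
Qed.

End GPRSTheory.

Theorem theorem1p4 (q : nat) (F : finFieldType) (hF : #|F| = q) (k l : nat)
    (k_gt0 : (0 < k)%N) (l_gt0 : (0 < l)%N) (q_ge5 : (5 <= q)%N)
    (k_ge2 : (2 <= k)%N) (k_le : (k <= minn (q - 3) (q - l - 1))%N)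
    (a : 'I_l -> F) (a_inj : injective a)
    (D : {set F}) (D_def : D = ~: [set a i | i : 'I_l])
    (y : 'I_(q - l) -> F) (y_inj : injective y)
    (y_range : [set y i | i : 'I_(q - l)] = D)
    (u : {poly F}) (deg_u : size u = k.+1) :
  deep_hole (GPRS y k) (gprs_word y k u) <->
  (forall I : {set F}, I \subset D -> #|I| = k -> \sum_(z in I) z != 0).
Proof.
have lt_kn : (k < q - l)%N by move: k_le k_gt0; lia.
have le_kn := ltnW lt_kn; set n := (q - l)%N in y y_inj y_range lt_kn le_kn *.
pose a0 := a (Ordinal l_gt0).
have ya i : y i != a0.
  apply/eqP=> yi; have : y i \in D by rewrite -y_range imset_f.
  by rewrite D_def yi inE imset_f.
have radiusE : (n + 1 - k = (n - k).+1)%N by rewrite addn1 subSn.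
rewrite /deep_hole (covering_radius_GPRS y_inj k_gt0 ya le_kn) radiusE.
have d_ge := error_dist_deg_k_ge y_inj deg_u.
have d_le := error_dist_GPRS_le y_inj (gprs_word y k u) le_kn.
rewrite radiusE in d_le.
have d_zero := error_dist_deg_k y_inj k_gt0 le_kn deg_u; rewrite y_range in d_zero.
split=> [[_ d_eq] I sID cI | no_I].
  apply/eqP=> sum0; have /d_zero d_eq' : exists I : {set F},
    [/\ I \subset D, #|I| = k & \sum_(z in I) z = 0] by exists I.
  by move: d_eq; rewrite d_eq' => /n_Sn.
split.
  apply/negP=> Cu; have := leq_trans d_ge (error_dist_le _ Cu).
  have -> : hamming_dist (gprs_word y k u) (gprs_word y k u) = 0%N.
    by apply: eq_card0 => i; rewrite !inE eqxx.
  by rewrite leqNgt subn_gt0 lt_kn.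
apply/eqP; rewrite eqn_leq d_le ltn_neqAle d_ge andbT eq_sym.
by apply/eqP=> /d_zero[I [sID cI /eqP]]; apply/negP/no_I.
Qed.
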